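(* Consider the single-loop problem (S) defined in the context in the energy-limited regime, where the constraints $D\le\rho D^{\mathrm s}$, $E^{\mathrm u}/t^{\mathrm u}\le P_{\mathrm{umax}}$, $E^{\mathrm d}/t^{\mathrm d}\le P_{\mathrm{dmax}}$ and $\left(E^{\mathrm c}/(\kappa t^{\mathrm c})\right)^{1/3}\le F_{\max}$ are inactive at the optimum. Then the optimal solution can be expressed in a semi-closed form parameterized by a scalar $\xi>0$, as follows. (1) Defining the uplink and downlink signal-to-noise ratios (SNRs) $$\gamma^{\mathrm u}=\frac{g^{\mathrm u}E^{\mathrm u}}{B_{\max}N_0t^{\mathrm u}},\qquad \gamma^{\mathrm d}=\frac{g^{\mathrm d}E^{\mathrm d}}{B_{\max}N_0t^{\mathrm d}},$$ the following equations must hold: $$\frac{\eta^{\mathrm s}g^{\mathrm u}}{(1+\gamma^{\mathrm u})\ln(1+\gamma^{\mathrm u})-\gamma^{\mathrm u}}=\xi,\qquad \frac{\eta^{\mathrm e}g^{\mathrm d}}{(1+\gamma^{\mathrm d})\ln(1+\gamma^{\mathrm d})-\gamma^{\mathrm d}}=\xi.$$ The left-hand sides are monotonically decreasing functions of $\gamma^{\mathrm u}$ and $\gamma^{\mathrm d}$, respectively. Therefore the SNRs are uniquely determined by $\xi$; these mappings are denoted $\gamma^{\mathrm u}=\gamma^{\mathrm u}(\xi)$ and $\gamma^{\mathrm d}=\gamma^{\mathrm d}(\xi)$, and they are decreasing functions of $\xi$. (2) The optimal time allocation is expressed in terms of $D$ and $\xi$ as $$t^{\mathrm u}=\frac{D}{\rho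 B_{\max}\log_2(1+\gamma^{\mathrm u}(\xi))},\quad t^{\mathrm d}=\frac{D}{B_{\max}\log_2(1+\gamma^{\mathrm d}(\xi))},\quad t^{\mathrm c}=\frac{\kappa^{1/3}\alpha}{\rho}\left(\frac{2\xi}{\eta^{\mathrm e}}\right)^{1/3}D,$$ and the optimal energy allocation is $$E^{\mathrm u}=\frac{\gamma^{\mathrm u}(\xi)N_0}{\rho g^{\mathrm u}\log_2(1+\gamma^{\mathrm u}(\xi))}D,\quad E^{\mathrm d}=\frac{\gamma^{\mathrm d}(\xi)N_0}{g^{\mathrm d}\log_2(1+\gamma^{\mathrm d}(\xi))}D,\quad E^{\mathrm c}=\frac{\kappa^{1/3}\alpha(\eta^{\mathrm e})^{2/3}}{2\rho}(2\xi)^{-2/3}D.$$ (3) Moreover, $\xi$ can be obtained by solving the one-dimensional equation $P_0A(\xi)-B(\xi)=0$, where $$A(\xi)=\frac{1}{\rho B_{\max}\log_2(1+\gamma^{\mathrm u}(\xi))}+\frac{1}{B_{\max}\log_2(1+\gamma^{\mathrm d}(\xi))}+\frac{\kappa^{1/3}\alpha}{\rho}\left(\frac{2\xi}{\eta^{\mathrm e}}\right)^{1/3},$$ $$B(\xi)=\frac{\gamma^{\mathrm u}(\xi)N_0}{\eta^{\mathrm s}\rho g^{\mathrm u}\log_2(1+\gamma^{\mathrm u}(\xi))}+\frac{\gamma^{\mathrm d}(\xi)N_0}{\eta^{\mathrm e}g^{\mathrm d}\log_2(1+\gamma^{\mathrm d}(\xi))}+\frac{\kappa^{1/3}\alpha(\eta^{\mathrm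 e})^{-1/3}}{2\rho}(2\xi)^{-2/3}.$$ After obtaining the optimal $\xi^\star$, the optimal objective value is $$D^\star=\frac{T}{A(\xi^\star)}=\frac{TP_0}{B(\xi^\star)},$$ and all optimal variables are obtained directly from the expressions above (with $\xi=\xi^\star$, $D=D^\star$).
   Context: The constants $g^{\mathrm u},g^{\mathrm d}$ (channel gains), $N_0$ (noise power spectral density), $B_{\max}$ (bandwidth), $\alpha$ (CPU cycles per bit), $\kappa$ (computation energy coefficient), $\eta^{\mathrm s},\eta^{\mathrm e}$ (energy transfer efficiencies), $P_0$ (maximum energy transfer power), $T$ (cycle time), $D^{\mathrm s},P_{\mathrm{umax}},P_{\mathrm{dmax}},F_{\max}$ are positive reals, and $\rho\in(0,1)$. Problem (S), with variables $D$ and the energies and times $E^{\mathrm u},E^{\mathrm c},E^{\mathrm d},t^{\mathrm u},t^{\mathrm c},t^{\mathrm d}$ of the uplink, computing and downlink stages: maximize $D$ subject to $D\le\rho D^{\mathrm s}$; $D\le\rho t^{\mathrm u}B_{\max}\log_2\left(1+\frac{g^{\mathrm u}E^{\mathrm u}}{t^{\mathrm u}B_{\max}N_0}\right)$; $D\le\rho t^{\mathrm c}\left(\frac{E^{\mathrm c}}{\alpha^3\kappa t^{\mathrm c}}\right)^{1/3}$; $D\le t^{\mathrm d}B_{\max}\log_2\left(1+\frac{g^{\mathrm d}E^{\mathrm d}}{t^{\mathrm d}B_{\max}N_0}\right)$; $t^{\mathrm u}+t^{\mathrm c}+t^{\mathrm d}\le T$; $\frac{E^{\mathrm u}}{\eta^{\mathrm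 s}}+\frac{E^{\mathrm c}+E^{\mathrm d}}{\eta^{\mathrm e}}\le P_0T$; $E^{\mathrm u}/t^{\mathrm u}\le P_{\mathrm{umax}}$; $E^{\mathrm d}/t^{\mathrm d}\le P_{\mathrm{dmax}}$; $\left(\frac{E^{\mathrm c}}{\kappa t^{\mathrm c}}\right)^{1/3}\le F_{\max}$.
   Formalization: Two constants are corrected: the SNR equations in (1) carry an extra factor B_max N_0 in the denominator, and the factor 1/2 in E^c and in the last term of B(ξ) is dropped; as printed, E^c and t^c violate the computing constraint (rate 2^{-1/3}D < D). *)

(* Defs.v *)
From HB Require Import structures.
From mathcomp Require Export all_boot all_order all_algebra.
From mathcomp Require Export all_classical all_reals all_analysis.

Set Implicit Arguments.
Unset Strict Implicit.
Unset Printing Implicit Defensive.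

Import Order.TTheory GRing.Theory Num.Theory.
Local Open Scope classical_set_scope.
Local Open Scope ring_scope.

Section SingleLoop.
Variable R : realType.

Definition log2 (x : R) : R := ln x / ln 2.

Record params := Params {
  gainU : R;     (* g^u *)
  gainD : R;     (* g^d *)
  N0 : R;
  Bmax : R;
  alpha : R;     (* CPU cycles per bit *)
  kappa : R;     (* computation energy coefficient *)
  etaS : R;      (* energy transfer efficiency, uplink side *)
  etaE : R;      (* energy transfer efficiency, computing and downlink side *)
  P0 : R;
  T : R;
  Ds : R;
  PUmax : R;
  PDmax : R;
  Fmax : R;
  rho : R }.

Definition admissible (s : params) : Prop :=
  [/\ [/\ 0 < gainU s, 0 < gainD s, 0 < N0 s & 0 < Bmax s],
      [/\ 0 < alpha s, 0 < kappa s, 0 < etaS s & 0 < etaE s],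
      [/\ 0 < P0 s, 0 < T s & 0 < Ds s],
      [/\ 0 < PUmax s, 0 < PDmax s & 0 < Fmax s] &
      0 < rho s < 1].

Record allocation := Allocation {
  D : R;
  Eu : R; Ec : R; Ed : R;
  tu : R; tc : R; td : R }.

Definition snrU (s : params) (p : allocation) : R :=
  gainU s * Eu p / (Bmax s * N0 s * tu p).

Definition snrD (s : params) (p : allocation) : R :=
  gainD s * Ed p / (Bmax s * N0 s * td p).

(* Times are divided by, and energies occur under a logarithm and a cube root:
   the problem is posed for positive times and nonnegative energies.  For a
   nonnegative base, [powR] with exponent 1/3 is the usual cube root, also
   at 0. *)
Definition feasible (s : params) (p : allocation) : Prop :=
  [/\ [/\ 0 < tu p, 0 < tc p & 0 < td p],
      [/\ 0 <= Eu p, 0 <= Ec p & 0 <= Ed p],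
      [/\ D p <= rho s * Ds s,
          D p <= rho s * tu p * Bmax s *
                 log2 (1 + gainU s * Eu p / (tu p * Bmax s * N0 s)),
          D p <= rho s * tc p *
                 powR (Ec p / (alpha s ^+ 3 * kappa s * tc p)) (1 / 3) &
          D p <= td p * Bmax s *
                 log2 (1 + gainD s * Ed p / (td p * Bmax s * N0 s))],
      tu p + tc p + td p <= T s /\
      Eu p / etaS s + (Ec p + Ed p) / etaE s <= P0 s * T s &
      [/\ Eu p / tu p <= PUmax s,
          Ed p / td p <= PDmax s &
          powR (Ec p / (kappa s * tc p)) (1 / 3) <= Fmax s]].

Definition optimal (s : params) (p : allocation) : Prop :=
  feasible s p /\ forall q, feasible s q -> D q <= D p.

Definition energy_limited_at (s : params) (p : allocation) : Prop :=
  [/\ D p < rho s * Ds s,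
      Eu p / tu p < PUmax s,
      Ed p / td p < PDmax s &
      powR (Ec p / (kappa s * tc p)) (1 / 3) < Fmax s].

(* Writing xi for the ratio of the multiplier of the energy constraint to that
   of the time constraint, stationarity in the energy and the time of a link
   with gain g and transfer efficiency eta reads xi_of_snr s eta g gamma = xi.
   The factor Bmax * N0 comes from gamma = g E / (Bmax N0 t); it is missing in
   the published equations, which agree with this one when Bmax * N0 = 1. *)
Definition xi_of_snr (s : params) (eta g gamma : R) : R :=
  eta * g / (Bmax s * N0 s * ((1 + gamma) * ln (1 + gamma) - gamma)).

(* The positive SNR determined by xi (0 if there is none). *)
Definition snr_of_xi (s : params) (eta g xi : R) : R :=
  xget 0 [set gamma | 0 < gamma /\ xi_of_snr s eta g gamma = xi].

Definition gammaU (s : params) (xi : R) : R := snr_of_xi s (etaS s) (gainU s) xi.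
Definition gammaD (s : params) (xi : R) : R := snr_of_xi s (etaE s) (gainD s) xi.

(* Stationarity for the computing stage is tc / Ec = 2 xi / etaE, and its rate
   constraint then gives [tc] and [Ec] below.  The published [Ec], and with it
   the last term of [Bfun], has a further factor 1/2, with which
   rho tc (Ec / (alpha^3 kappa tc))^(1/3) would be 2^(-1/3) D < D. *)
Definition closed_form (s : params) (xi d : R) : allocation := {|
  D := d;
  Eu := gammaU s xi * N0 s / (rho s * gainU s * log2 (1 + gammaU s xi)) * d;
  Ec := powR (kappa s) (1 / 3) * alpha s * powR (etaE s) (2 / 3) / rho s *
        powR (2 * xi) (- (2 / 3)) * d;
  Ed := gammaD s xi * N0 s / (gainD s * log2 (1 + gammaD s xi)) * d;
  tu := d / (rho s * Bmax s * log2 (1 + gammaU s xi));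
  tc := powR (kappa s) (1 / 3) * alpha s / rho s *
        powR (2 * xi / etaE s) (1 / 3) * d;
  td := d / (Bmax s * log2 (1 + gammaD s xi)) |}.

Definition Afun (s : params) (xi : R) : R :=
  1 / (rho s * Bmax s * log2 (1 + gammaU s xi)) +
  1 / (Bmax s * log2 (1 + gammaD s xi)) +
  powR (kappa s) (1 / 3) * alpha s / rho s * powR (2 * xi / etaE s) (1 / 3).

Definition Bfun (s : params) (xi : R) : R :=
  gammaU s xi * N0 s /
    (etaS s * rho s * gainU s * log2 (1 + gammaU s xi)) +
  gammaD s xi * N0 s / (etaE s * gainD s * log2 (1 + gammaD s xi)) +
  powR (kappa s) (1 / 3) * alpha s * powR (etaE s) (- (1 / 3)) / rho s *
    powR (2 * xi) (- (2 / 3)).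

Definition decreasing_pos (f : R -> R) : Prop :=
  forall x y : R, 0 < x -> x < y -> f y < f x.

End SingleLoop.

(* Main.v *)
(* Perturb an optimal allocation p along a ray.  Every stage has a rate that is
   homogeneous of degree one in its time and energy, so shrinking the stage
   scales its rate linearly, and a positive directional derivative makes the
   rate exceed D p for small steps.  Hence at the optimum no resource and no
   rate constraint is slack (a slack one could be traded for a gain of all three
   rates), and the marginal rates of substitution between time and budgeted
   energy agree across the stages (otherwise two stages could exchange time for
   energy with profit and subsidise the third).  The common rate is 1 / xi; the
   tight rate constraints then give the closed forms, and the two tight budgets
   read D A(xi) = T and D B(xi) = P0 T.  As A increases and B decreases,
   P0 A - B has a single zero. *)
Require Import Defs.
From mathcomp Require Import ring lra.

Set Implicit Arguments.
Unset Strict Implicit.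
Unset Printing Implicit Defensive.

Import Order.TTheory GRing.Theory Num.Theory.
Import numFieldNormedType.Exports.
Local Open Scope classical_set_scope.
Local Open Scope ring_scope.

(** * Logarithm bounds and the SNR cost function *)

Lemma ln_sub_le (R : realType) (x y : R) :
  0 < x -> 0 < y -> ln x - ln y <= (x - y) / y.
Proof.
move=> x0 y0; rewrite -ln_div ?posrE//.
rewrite (_ : x / y = 1 + (x - y) / y); last by field; rewrite gt_eqF.
apply: le_ln1Dx; rewrite -subr_gt0 opprK.
by rewrite (_ : _ + 1 = x / y) ?divr_gt0//; field; rewrite gt_eqF.
Qed.

Lemma div_add1_le_ln (R : realType) (x : R) : 0 <= x -> x / (1 + x) <= ln (1 + x).
Proof.
move=> x0; have x1 : 0 < 1 + x by lra.
have := @ln_sub_le R 1 (1 + x) ltr01 x1.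
rewrite ln1 (_ : (1 - _) / _ = - (x / (1 + x))); first by lra.
by field; rewrite gt_eqF.
Qed.

Lemma ln_add1_gt0 (R : realType) (x : R) : 0 < x -> 0 < ln (1 + x).
Proof. by move=> x0; rewrite ln_gt0// ltrDl. Qed.

Lemma ln2_gt0 (R : realType) : 0 < ln 2 :> R.
Proof. by rewrite ln_gt0// ltr1n. Qed.

(* Up to a factor independent of [x], the marginal rate of substitution of
   energy for time on a link with SNR [x]. *)
Definition snr_cost {R : realType} (x : R) : R := (1 + x) * ln (1 + x) - x.

(** With [a] and [b] the logarithms at [x] and [y], the costs differ by (1 + y)(b - a) + (y - x)a -
    (y - x). The tangent bound makes the first term at least y - x, which leaves (y - x)a > 0. *)
Lemma snr_cost_lt (R : realType) (x y : R) :
  0 < x -> x < y -> snr_cost x < snr_cost y.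
Proof.
move=> x0 xy; rewrite /snr_cost.
have x1 : 0 < 1 + x by lra.
have y1 : 0 < 1 + y by lra.
have lx := @div_add1_le_ln R x (ltW x0); rewrite ler_pdivrMr// in lx.
have ly : 1 - (1 + x)/ (1 + y) <= ln (1 + y) - ln (1 + x).
  have := @ln_sub_le R _ _ x1 y1.
  by rewrite mulrBl divff ?gt_eqF//; lra.
have d : (1 + x)/ (1 + y) < 1 by rewrite ltr_pdivrMr//; lra.
have e : (1 + x) = (1 + x)/ (1 + y) * (1 + y) by rewrite divfK ?gt_eqF.
have l0 := @ln_add1_gt0 R x x0.
set r := (1 + x) / (1 + y) in ly d e; set a := ln (1 + x) in lx ly l0 *.
set b := ln _ in ly *; have : (1 + y) * (1 - r) <= (1 + y) * (b - a) by rewrite ler_pM2l.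
have : 0 < (y - x) * a by rewrite mulr_gt0// subr_gt0.
nra.
Qed.

Lemma snr_cost_gt0 (R : realType) (x : R) : 0 < x -> 0 < snr_cost x.
Proof.
(* [snr_cost_lt] compares positive arguments only, so x / 2 stands in for 0; there [div_add1_le_ln]
   gives a nonnegative cost. *)
move=> x0; apply: (@le_lt_trans _ _ (snr_cost (x / 2))); last first.
  by apply: snr_cost_lt; lra.
have := @div_add1_le_ln R (x / 2); rewrite /snr_cost.
by rewrite ler_pdivrMr; lra.
Qed.

Lemma snr_cost_surj (R : realType) (c : R) :
  0 < c -> exists2 x, 0 < x & snr_cost x = c.
Proof.
(* This is the cost after the substitution 1 + x = exp s, which is continuous on the whole line; f(1
   + c) = c exp(1 + c) + 1 exceeds c. *)
move=> c0; pose f (s : R) := expR s * (s - 1) + 1.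
have cf : continuous f.
  move=> s; apply: cvgD; last exact: cvg_cst.
  apply: cvgM; first exact: continuous_expR.
  by apply: cvgB; [exact: cvg_id|exact: cvg_cst].
have f0 : f 0 = 0 by rewrite /f expR0; lra.
have fc : c <= f (1 + c).
  rewrite /f; have := @expR_ge1Dx R (1 + c); nra.
have c1 : 0 <= 1 + c by lra.
have [|s] := @IVT R f 0 (1 + c) c c1 (continuous_subspaceT cf).
  by rewrite f0 min_l ?max_r; lra.
rewrite in_itv/= => /andP[s0 _] fs.
have {}s0 : 0 < s.
  by rewrite lt_neqAle s0 andbT; apply/eqP => s00; move: fs; rewrite -s00 f0; lra.
exists (expR s - 1); first by rewrite subr_gt0 expR_gt1.
rewrite /snr_cost (_ : 1 + (expR s - 1) = expR s); last by ring.
by rewrite expRK -fs /f; ring.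
Qed.

(** * The bijection between positive SNRs and positive values of xi *)

Section Snr.
Variables (R : realType) (s : params R) (eta g : R).
Hypotheses (eta0 : 0 < eta) (g0 : 0 < g) (B0 : 0 < Bmax s) (n0 : 0 < N0 s).

Lemma xi_of_snrE x : xi_of_snr s eta g x = eta * g / (Bmax s * N0 s * snr_cost x).
Proof. by []. Qed.

Lemma xi_of_snr_gt0 x : 0 < x -> 0 < xi_of_snr s eta g x.
Proof.
by move=> x0; rewrite xi_of_snrE divr_gt0 ?mulr_gt0 ?snr_cost_gt0.
Qed.

Lemma decreasing_xi_of_snr : decreasing_pos (xi_of_snr s eta g).
Proof.
move=> x y x0 xy; rewrite !xi_of_snrE ltr_pM2l ?mulr_gt0//.
have y0 : 0 < y := lt_trans x0 xy.
by rewrite ltf_pV2 ?posrE ?mulr_gt0 ?snr_cost_gt0// ltr_pM2l ?mulr_gt0// snr_cost_lt.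
Qed.

Lemma xi_of_snr_inj x y :
  0 < x -> 0 < y -> xi_of_snr s eta g x = xi_of_snr s eta g y -> x = y.
Proof.
move=> x0 y0 e; have [xy|xy|//] := ltgtP x y.
- by have := decreasing_xi_of_snr x0 xy; rewrite e ltxx.
- by have := decreasing_xi_of_snr y0 xy; rewrite e ltxx.
Qed.

Lemma xi_of_snr_surj (xi : R) :
  0 < xi -> exists x, 0 < x /\ xi_of_snr s eta g x = xi.
Proof.
move=> xi0.
have [|x x0 xE] := @snr_cost_surj R (eta * g / (Bmax s * N0 s * xi)).
  by rewrite divr_gt0 ?mulr_gt0.
by exists x; split=> //; rewrite xi_of_snrE xE; field; rewrite !gt_eqF.
Qed.

(** By surjectivity the set under [xget] is inhabited, so its default 0 is never returned. *)
Lemma snr_of_xiP (xi : R) : 0 < xi ->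
  0 < snr_of_xi s eta g xi /\ xi_of_snr s eta g (snr_of_xi s eta g xi) = xi.
Proof.
move=> xi0.
exact: (@xgetPex _ 0 [set x | 0 < x /\ xi_of_snr s eta g x = xi])
  (xi_of_snr_surj xi0).
Qed.

Lemma snr_of_xi_of_snr x : 0 < x -> snr_of_xi s eta g (xi_of_snr s eta g x) = x.
Proof.
move=> x0; have [y0 yE] := snr_of_xiP (xi_of_snr_gt0 x0).
exact: xi_of_snr_inj yE.
Qed.

Lemma unique_snr (xi : R) :
  0 < xi -> exists! gamma, 0 < gamma /\ xi_of_snr s eta g gamma = xi.
Proof.
move=> xi0; have [x [x0 xE]] := xi_of_snr_surj xi0.
exists x; split=> // y [y0 yE]; apply: xi_of_snr_inj => //.
by rewrite xE yE.
Qed.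

Lemma decreasing_snr_of_xi : decreasing_pos (snr_of_xi s eta g).
Proof.
move=> x y x0 xy; have y0 : 0 < y := lt_trans x0 xy.
have [a0 aE] := snr_of_xiP x0; have [b0 bE] := snr_of_xiP y0.
rewrite ltNge; apply/negP; rewrite le_eqVlt => /orP[/eqP ab|ab].
  by move: xy; rewrite -aE -bE ab ltxx.
by have := decreasing_xi_of_snr a0 ab; rewrite aE bE ltNge (ltW xy).
Qed.

End Snr.

(** * Small steps, and exchanges between stages *)

Lemma near_affine_gt0 (R : realType) (a b : R) :
  0 < a -> \forall h \near (0 : R)^'+, 0 < a + h * b.
Proof.
move=> a0; have d0 : 0 < `|b| + 1 by rewrite ltr_wpDl.
near=> h.
have h0 : 0 < h by near: h; exact: nbhs_right_gt.
(* The added 1 keeps the threshold meaningful when b = 0. *)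
have : h < a / (`|b| + 1) by near: h; apply: nbhs_right_lt; rewrite divr_gt0.
rewrite ltr_pdivlMr// => hd.
have : - (h * b) <= h * `|b| by rewrite -mulrN ler_pM2l// -normrN ler_norm.
nra.
Unshelve. all: by end_near. Qed.

(** Meant for budgets: a slack one tolerates every direction, a tight one only those that do not
    consume it. *)
Lemma near_slack (R : realType) (a b : R) : 0 < a \/ 0 <= b -> 0 <= a ->
  \forall h \near (0 : R)^'+, 0 <= a + h * b.
Proof.
move=> [a0|b0] a0'; near=> h; last first.
  by rewrite addr_ge0// mulr_ge0// ltW//; near: h; exact: nbhs_right_gt.
by rewrite ltW//; near: h; exact: near_affine_gt0.
Unshelve. all: by end_near. Qed.

(** Stage 1 values time, relative to energy, more than stage 2 does. It buys time from stage 2 at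
    the mediant price (a1 + a2) / (b1 + b2), which lies between their marginal rates and earns each
    of them a1 b2 - a2 b1. *)
Lemma opposite_tradeoff (R : realType) (a1 b1 a2 b2 a3 b3 : R) :
  0 < a1 -> 0 < b1 -> 0 < a2 -> 0 < b2 -> 0 < a3 -> 0 < b3 ->
  a2 * b1 < a1 * b2 ->
  exists dt de : R * R * R,
    [/\ dt.1.1 + dt.1.2 + dt.2 = 0, de.1.1 + de.1.2 + de.2 = 0,
        0 < a1 * dt.1.1 + b1 * de.1.1, 0 < a2 * dt.1.2 + b2 * de.1.2 &
        0 < a3 * dt.2 + b3 * de.2].
Proof.
move=> a10 b10 a20 b20 a30 b30 d0.
(* The time passed on to stage 3; it costs stage 1 half of its profit. *)
pose e := (a1 * b2 - a2 * b1) / (2 * a1).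
have e0 : 0 < e by rewrite divr_gt0 ?mulr_gt0// subr_gt0.
have ae : a1 * e = (a1 * b2 - a2 * b1) / 2 by rewrite /e; field; rewrite gt_eqF.
exists (b1 + b2 - e, - (b1 + b2), e), (- (a1 + a2), a1 + a2, 0) => /=.
split; [by lra|by lra| | |by rewrite mulr0 addr0 mulr_gt0].
  by rewrite mulrBr ae; lra.
by lra.
Qed.

(* [Ii dt de] says that stage [i] strictly benefits from moving its time and
   its share of the energy budget in the direction [(dt, de)]. *)
Lemma no_joint_improvement (R : realType) (I1 I2 I3 : R -> R -> Prop)
    (slackT slackE slack1 slack2 slack3 : Prop)
    (t1 t2 t3 e1 e2 e3 a1 b1 a2 b2 a3 b3 : R) :
  0 < t1 -> 0 < t2 -> 0 < t3 -> 0 < e1 -> 0 < e2 -> 0 < e3 ->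
  0 < a1 -> 0 < b1 -> 0 < a2 -> 0 < b2 -> 0 < a3 -> 0 < b3 ->
  (forall dt de, 0 < a1 * dt + b1 * de -> I1 dt de) ->
  (forall dt de, 0 < a2 * dt + b2 * de -> I2 dt de) ->
  (forall dt de, 0 < a3 * dt + b3 * de -> I3 dt de) ->
  (slack1 -> I1 (- t1) (- e1)) ->
  (slack2 -> I2 (- t2) (- e2)) ->
  (slack3 -> I3 (- t3) (- e3)) ->
  (forall dt1 dt2 dt3 de1 de2 de3,
     slackT \/ dt1 + dt2 + dt3 <= 0 -> slackE \/ de1 + de2 + de3 <= 0 ->
     I1 dt1 de1 -> I2 dt2 de2 -> ~ I3 dt3 de3) ->
  [/\ ~ slackT, ~ slackE, [/\ ~ slack1, ~ slack2 & ~ slack3],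
      a1 * b2 = a2 * b1 & a1 * b3 = a3 * b1].
Proof.
move=> t10 t20 t30 e10 e20 e30 a10 b10 a20 b20 a30 b30 H1 H2 H3 S1 S2 S3 no.
have pos x y u v : 0 < x -> 0 < y -> 0 < u -> 0 < v ->
    0 < x * (u / 2) + y * (v / 2) :> R.
  by move=> *; rewrite addr_gt0// mulr_gt0// divr_gt0.
split.
(* Slack time is handed to all three stages at once; slack energy likewise below. *)
- move=> sT; apply: (no 1 1 1 0 0 0).
  + by left.
  + by right; lra.
  + by apply: H1; lra.
  + by apply: H2; lra.
  + by apply: H3; lra.
- move=> sE; apply: (no 0 0 0 1 1 1).
  + by right; lra.
  + by left.
  + by apply: H1; lra.
  + by apply: H2; lra.
  + by apply: H3; lra.
- split.
  (* A stage with slack rate shrinks, and the other two share what it releases equally. *)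
  + move=> s; apply: (no (- t1) (t1 / 2) (t1 / 2) (- e1) (e1 / 2) (e1 / 2)).
    * by right; lra.
    * by right; lra.
    * exact: S1.
    * by apply: H2; exact: pos.
    * by apply: H3; exact: pos.
  + move=> s; apply: (no (t2 / 2) (- t2) (t2 / 2) (e2 / 2) (- e2) (e2 / 2)).
    * by right; lra.
    * by right; lra.
    * by apply: H1; exact: pos.
    * exact: S2.
    * by apply: H3; exact: pos.
  + move=> s; apply: (no (t3 / 2) (t3 / 2) (- t3) (e3 / 2) (e3 / 2) (- e3)).
    * by right; lra.
    * by right; lra.
    * by apply: H1; exact: pos.
    * by apply: H2; exact: pos.
    * exact: S3.
(* In each strict case the stage with the larger ratio a / b takes the first place in
   [opposite_tradeoff], hence the permuted arguments. *)
- have [l|l|//] := ltgtP (a1 * b2) (a2 * b1).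
  + have [[[x1 x2] x3] [[[y1 y2] y3] /= [sx sy p2 p1 p3]]] :=
      opposite_tradeoff a20 b20 a10 b10 a30 b30 l.
    have [] := no x2 x1 x3 y2 y1 y3; [right; lra|right; lra|exact: H1|
      exact: H2|exact: H3].
  + have [[[x1 x2] x3] [[[y1 y2] y3] /= [sx sy p1 p2 p3]]] :=
      opposite_tradeoff a10 b10 a20 b20 a30 b30 l.
    have [] := no x1 x2 x3 y1 y2 y3; [right; lra|right; lra|exact: H1|
      exact: H2|exact: H3].
- have [l|l|//] := ltgtP (a1 * b3) (a3 * b1).
  + have [[[x1 x2] x3] [[[y1 y2] y3] /= [sx sy p3 p1 p2]]] :=
      opposite_tradeoff a30 b30 a10 b10 a20 b20 l.
    have [] := no x2 x3 x1 y2 y3 y1; [right; lra|right; lra|exact: H1|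
      exact: H2|exact: H3].
  + have [[[x1 x2] x3] [[[y1 y2] y3] /= [sx sy p1 p3 p2]]] :=
      opposite_tradeoff a10 b10 a30 b30 a20 b20 l.
    have [] := no x1 x3 x2 y1 y3 y2; [right; lra|right; lra|exact: H1|
      exact: H2|exact: H3].
Qed.

(** [power] caps the quotient of energy by time; through [cpu_cap] the CPU frequency limit also
    takes this form, so one notion serves all stages. *)
Definition improving (R : realType) (rate : R -> R -> R)
    (d power t e dt de : R) : Prop :=
  \forall h \near (0 : R)^'+,
    [/\ 0 < t + h * dt, 0 < e + h * de, d < rate (t + h * dt) (e + h * de) &
        (e + h * de) / (t + h * dt) < power].

Lemma near_caps (R : realType) (power t e dt de : R) :
  0 < t -> 0 < e -> e / t < power ->
  \forall h \near (0 : R)^'+,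
    [/\ 0 < t + h * dt, 0 < e + h * de &
        (e + h * de) / (t + h * dt) < power].
Proof.
move=> t0 e0; rewrite ltr_pdivrMr// -subr_gt0 => cap.
near=> h.
have th : 0 < t + h * dt by near: h; exact: near_affine_gt0.
split=> //; first by near: h; exact: near_affine_gt0.
(* Cleared of its denominator, the cap is affine in [h]. *)
rewrite ltr_pdivrMr// -subr_gt0.
have -> : power * (t + h * dt) - (e + h * de) =
    (power * t - e) + h * (power * dt - de) by ring.
by near: h; exact: near_affine_gt0.
Unshelve. all: by end_near. Qed.

(** The ray is (1 - h)(t, e), along which a homogeneous rate is affine in [h], so the strict margin
    over [d] survives small steps. *)
Lemma improving_shrink (R : realType) (rate : R -> R -> R) (d power t e : R) :
  (forall k t e, 0 < k -> rate (k * t) (k * e) = k * rate t e) ->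
  0 < t -> 0 < e -> e / t < power -> d < rate t e ->
  improving rate d power t e (- t) (- e).
Proof.
move=> homog t0 e0 cap dr; rewrite /improving.
near=> h.
have [th eh caph] : [/\ 0 < t + h * - t, 0 < e + h * - e &
    (e + h * - e) / (t + h * - t) < power] by near: h; exact: near_caps.
split=> //.
have h1 : 0 < 1 - h.
  by rewrite (_ : 1 - h = 1 + h * -1); [near: h; exact: near_affine_gt0|ring].
rewrite (_ : t + h * - t = (1 - h) * t); last by ring.
rewrite (_ : e + h * - e = (1 - h) * e); last by ring.
rewrite homog// -subr_gt0.
rewrite (_ : _ - d = (rate t e - d) + h * - rate t e); last by ring.
by near: h; apply: near_affine_gt0; rewrite subr_gt0.
Unshelve. all: by end_near. Qed.

(** * Rates of the uplink and the downlink *)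

Section Link.
Variables (R : realType) (c B N g : R).
Hypotheses (c0 : 0 < c) (B0 : 0 < B) (N0 : 0 < N) (g0 : 0 < g).

(** The factor [c] is [rho] for the uplink and 1 for the downlink. *)
Definition link_rate (t e : R) : R :=
  c * t * B * log2 (1 + g * e / (t * B * N)).

Lemma link_rate_homog k t e :
  0 < k -> link_rate (k * t) (k * e) = k * link_rate t e.
Proof.
move=> k0; rewrite /link_rate.
have -> : g * (k * e) / (k * t * B * N) = g * e / (t * B * N).
  have [->|t0] := eqVneq t 0; first by rewrite !(mulr0, mul0r, invr0).
  by field; rewrite t0 !gt_eqF.
by ring.
Qed.

Lemma link_rate_gt0 t e : 0 < t -> 0 < e -> 0 < link_rate t e.
Proof.
move=> t0 e0; rewrite /link_rate /log2.
have : 0 < ln (1 + g * e / (t * B * N)).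
  by rewrite ln_add1_gt0// divr_gt0// !mulr_gt0.
by move=> l0; rewrite !mulr_gt0// invr_gt0 ln2_gt0.
Qed.

(* The bound [ln y - ln x >= 1 - x / y] replaces the rate gain by a quantity
   whose sign is that of a function affine in the step [h]. *)
Lemma link_improving d power t e dt de :
  0 < t -> 0 < e -> e / t < power -> d <= link_rate t e ->
  0 < snr_cost (g * e / (B * N * t)) * dt + g / (B * N) * de ->
  improving link_rate d power t e dt de.
Proof.
move=> t0 e0 cap dr; rewrite /snr_cost /improving.
pose k := g / (B * N).
have k0 : 0 < k by rewrite divr_gt0// mulr_gt0.
have snrE t' e' : 0 < t' -> g * e' / (t' * B * N) = k * e' / t'.
  by move=> t'0; rewrite /k; field; rewrite !gt_eqF.
have -> : g * e / (B * N * t) = k * e / t by rewrite /k; field; rewrite !gt_eqF.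
rewrite -/k; set L := ln (1 + k * e / t) => grad.
near=> h.
have h0 : 0 < h by near: h; exact: nbhs_right_gt.
have [th eh caph] : [/\ 0 < t + h * dt, 0 < e + h * de &
    (e + h * de) / (t + h * dt) < power] by near: h; exact: near_caps.
split=> //; apply: (le_lt_trans dr).
rewrite /link_rate !snrE// /log2 -/L.
(* The constant term is [t] times the directional derivative assumed positive in [grad]. *)
have affine : 0 < (dt * L * (t + k * e) + (k * de * t - dt * (k * e))) +
    h * (dt * L * (dt + k * de) + (k * de - dt * (k * e / t)) * dt).
  near: h; apply: near_affine_gt0.
  rewrite [ltRHS](_ : _ = t * (((1 + k * e / t) * L - k * e / t) * dt + k * de)).
    by rewrite mulr_gt0.
  by field; rewrite gt_eqF.
set t' := t + h * dt in th *; set e' := e + h * de in eh *.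
have w0 : 0 < t' + k * e' by rewrite addr_gt0// mulr_gt0.
have gap : 0 < dt * L * (t' + k * e') + (k * de - dt * (k * e / t)) * t'.
  rewrite [ltRHS](_ : _ = (dt * L * (t + k * e) + (k * de * t - dt * (k * e))) +
    h * (dt * L * (dt + k * de) + (k * de - dt * (k * e / t)) * dt)) //.
  by rewrite /t' /e'; field; rewrite gt_eqF.
have chord : 1 - (1 + k * e / t) / (1 + k * e' / t') <=
    ln (1 + k * e' / t') - L.
  have s0 : 0 < 1 + k * e / t by rewrite addr_gt0// divr_gt0// mulr_gt0.
  have s'0 : 0 < 1 + k * e' / t' by rewrite addr_gt0// divr_gt0// mulr_gt0.
  by have := ln_sub_le s0 s'0; rewrite mulrBl divff ?gt_eqF// -/L; lra.
suff tL : t * L < t' * ln (1 + k * e' / t').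
  have q0 : 0 < c * B / ln 2 by rewrite divr_gt0 ?mulr_gt0 ?ln2_gt0.
  have -> : c * t * B * (L / ln 2) = c * B / ln 2 * (t * L) by ring.
  rewrite [ltRHS](_ : _ = c * B / ln 2 * (t' * ln (1 + k * e' / t'))).
    by rewrite ltr_pM2l.
  by ring.
have : t' * (1 - (1 + k * e / t) / (1 + k * e' / t')) <=
    t' * (ln (1 + k * e' / t') - L) by rewrite ler_pM2l.
rewrite mulrBr; apply: contraTT; rewrite -!leNgt -!ltNge => tL.
(* The gain in time times logarithm is t' (ln(1 + k e' / t') - L) + h dt L. After the chord bound it
   becomes h / (t' + k e') times the quantity in [gap]. *)
suff : 0 < t' * (1 - (1 + k * e / t) / (1 + k * e' / t')) + h * dt * L.
  by rewrite /t' in tL *; lra.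
rewrite [ltRHS](_ : _ = h / (t' + k * e') *
  (dt * L * (t' + k * e') + (k * de - dt * (k * e / t)) * t')).
  by rewrite mulr_gt0// divr_gt0.
have w1 : t' + k * e' != 0 by rewrite gt_eqF.
rewrite /t' /e' in w1 th *; field; rewrite w1 !gt_eqF//.
Unshelve. all: by end_near. Qed.

End Link.

(** * Cube roots and the computing rate *)

Lemma cube_powR13 (R : realType) (x : R) : 0 <= x -> (x `^ (1 / 3)) ^+ 3 = x.
Proof.
move=> x0; rewrite -powR_mulrn ?powR_ge0// -powRrM.
by rewrite (_ : 1 / 3 * 3%:R = 1) ?powRr1//; field.
Qed.

Lemma cube_inj (R : realType) (x y : R) : 0 <= x -> 0 <= y -> x ^+ 3 = y ^+ 3 -> x = y.
Proof. by move=> x0 y0; apply: pexpIrn; rewrite ?nnegrE. Qed.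

Lemma powR13_lt (R : realType) (x f : R) :
  0 <= x -> 0 < f -> (x `^ (1 / 3) < f) = (x < f ^+ 3).
Proof.
move=> x0 f0; rewrite -{2}(cube_powR13 x0).
by rewrite ltr_pXn2r ?nnegrE ?powR_ge0// ltW.
Qed.

Lemma powR23E (R : realType) (x : R) : x `^ (2 / 3) = (x `^ (1 / 3)) ^+ 2.
Proof.
rewrite -powR_mulrn ?powR_ge0// -powRrM.
by rewrite (_ : 1 / 3 * 2%:R = 2 / 3)//; field.
Qed.

Section Comp.
Variables (R : realType) (rho alpha kappa : R).
Hypotheses (rho0 : 0 < rho) (alpha0 : 0 < alpha) (kappa0 : 0 < kappa).

Definition comp_rate (t e : R) : R :=
  rho * t * powR (e / (alpha ^+ 3 * kappa * t)) (1 / 3).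

Lemma comp_rate_homog k t e :
  0 < k -> comp_rate (k * t) (k * e) = k * comp_rate t e.
Proof.
move=> k0; rewrite /comp_rate.
have -> : k * e / (alpha ^+ 3 * kappa * (k * t)) = e / (alpha ^+ 3 * kappa * t).
  have [->|t0] := eqVneq t 0; first by rewrite !(mulr0, invr0).
  by field; rewrite t0 !gt_eqF.
by ring.
Qed.

Lemma comp_rate_ge0 t e : 0 < t -> 0 <= comp_rate t e.
Proof. by move=> t0; rewrite !mulr_ge0 ?powR_ge0// ltW. Qed.

Lemma comp_rate_gt0 t e : 0 < t -> 0 < e -> 0 < comp_rate t e.
Proof.
by move=> t0 e0; rewrite !mulr_gt0// powR_gt0// divr_gt0// !mulr_gt0// exprn_gt0.
Qed.

(** Cubing removes the root, so computing rates are compared through the monomial t^2 e. *)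
Lemma comp_rate_cube t e : 0 < t -> 0 <= e ->
  comp_rate t e ^+ 3 = rho ^+ 3 / (alpha ^+ 3 * kappa) * (t ^+ 2 * e).
Proof.
move=> t0 e0; rewrite /comp_rate exprMn cube_powR13.
  by field; rewrite !gt_eqF.
by rewrite divr_ge0// !mulr_ge0// ?exprn_ge0// ltW.
Qed.

Lemma comp_improving d power t e dt de :
  0 < t -> 0 < e -> e / t < power -> d <= comp_rate t e ->
  0 < 2 * e * dt + t * de ->
  improving comp_rate d power t e dt de.
Proof.
move=> t0 e0 cap dr grad; rewrite /improving.
near=> h.
have h0 : 0 < h by near: h; exact: nbhs_right_gt.
have h1 : h < 1 by near: h; apply: nbhs_right_lt.
have [th eh caph] : [/\ 0 < t + h * dt, 0 < e + h * de &
    (e + h * de) / (t + h * dt) < power] by near: h; exact: near_caps.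
split=> //; apply: (le_lt_trans dr).
rewrite -(@ltr_pXn2r _ 3)// ?nnegrE ?comp_rate_ge0//.
rewrite !comp_rate_cube ?ltW// ltr_pM2l; last first.
  by rewrite divr_gt0// ?mulr_gt0// exprn_gt0.
(* The increment of t^2 e is a cubic in [h] with leading coefficient [y] and linear coefficient t (2
   e dt + t de). As h < 1, bounding h y below by -|y| leaves [h] times an affine function. *)
pose y := dt ^+ 2 * de.
have gap : 0 < t * (2 * e * dt + t * de) +
    h * (e * dt ^+ 2 + 2 * t * dt * de - `|y|).
  by near: h; apply: near_affine_gt0; rewrite mulr_gt0.
have hy : - `|y| <= h * y.
  rewrite lerNl -mulrN (le_trans (ler_norm _))// normrM normrN gtr0_norm//.
  by rewrite ler_piMl// ltW.
rewrite -subr_gt0 [ltRHS](_ : _ = h * (t * (2 * e * dt + t * de) +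
    h * (e * dt ^+ 2 + 2 * t * dt * de + h * y))); last by rewrite /y; ring.
rewrite mulr_gt0// (lt_le_trans gap)// lerD2l ler_pM2l//.
by rewrite lerD2l.
Unshelve. all: by end_near. Qed.

(** Stationarity eliminates [e]; the cubed rate equation then determines t^3, and [e] follows from
    [t]. *)
Lemma comp_closed_form d t e eta xi :
  0 < t -> 0 < e -> 0 < eta -> 0 < xi -> 0 <= d ->
  d = comp_rate t e -> t * eta = 2 * xi * e ->
  t = powR kappa (1 / 3) * alpha / rho * powR (2 * xi / eta) (1 / 3) * d /\
  e = powR kappa (1 / 3) * alpha * powR eta (2 / 3) / rho *
      powR (2 * xi) (- (2 / 3)) * d.
Proof.
move=> t0 e0 eta0 xi0 d0 dE teta.
have eE : e = t * eta / (2 * xi) by rewrite teta; field; rewrite gt_eqF.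
have xi20 : 0 < 2 * xi by rewrite mulr_gt0.
have tE : t = powR kappa (1 / 3) * alpha / rho * powR (2 * xi / eta) (1 / 3) * d.
  apply: cube_inj; first exact: ltW.
    rewrite !mulr_ge0 ?powR_ge0// ltW// invr_gt0//.
  rewrite !exprMn cube_powR13 ?(ltW kappa0)// cube_powR13; last first.
    by rewrite ltW// divr_gt0.
  rewrite dE comp_rate_cube ?ltW// eE.
  by field; rewrite !gt_eqF.
split=> //; rewrite eE {1}tE powRN !powR23E powRM ?(ltW xi20) ?invr_ge0 ?(ltW eta0)//.
have -> : eta^-1 `^ (1 / 3) = (eta `^ (1 / 3))^-1.
  by rewrite -(powR_inv1 (ltW eta0)) -powRrM mulrC powRrM powR_inv1 ?powR_ge0.
have X0 : 0 < (2 * xi) `^ (1 / 3) by exact: powR_gt0.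
have Y0 : 0 < eta `^ (1 / 3) by exact: powR_gt0.
have := cube_powR13 (ltW eta0); have := cube_powR13 (ltW xi20).
(* Writing 2 xi = X^3 and eta = Y^3 turns the claim into a rational identity. *)
set X := (2 * xi) `^ (1 / 3) in X0 *; set Y := eta `^ (1 / 3) in Y0 *.
by move=> <- <-; field; rewrite !gt_eqF.
Qed.

End Comp.

(** At a fixed SNR the rate is linear in [t], and the energy is gamma B N t / g. *)
Lemma link_closed_form (R : realType) (c B N g d t e gamma : R) :
  0 < c -> 0 < B -> 0 < N -> 0 < g -> 0 < t -> 0 < e ->
  gamma = g * e / (B * N * t) -> d = link_rate c B N g t e ->
  t = d / (c * B * log2 (1 + gamma)) /\
  e = gamma * N / (c * g * log2 (1 + gamma)) * d.
Proof.
move=> c0 B0 N0 g0 t0 e0 gE dE.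
have gamma0 : 0 < gamma by rewrite gE divr_gt0// !mulr_gt0.
have L0 : 0 < log2 (1 + gamma) by rewrite divr_gt0 ?ln2_gt0 ?ln_add1_gt0.
have tE : t = d / (c * B * log2 (1 + gamma)).
  rewrite dE /link_rate (_ : g * e / (t * B * N) = gamma).
    by field; rewrite !gt_eqF.
  by rewrite gE; field; rewrite !gt_eqF.
split=> //.
have -> : gamma * N / (c * g * log2 (1 + gamma)) * d =
    gamma * N * B / g * (d / (c * B * log2 (1 + gamma))).
  by field; rewrite !gt_eqF.
by rewrite -tE gE; field; rewrite !gt_eqF.
Qed.

(** * Monotonicity in the SNR *)

Section Log2.
Variable R : realType.
Implicit Types x y : R.

Lemma log2_add1_gt0 x : 0 < x -> 0 < log2 (1 + x).
Proof. by move=> x0; rewrite divr_gt0 ?ln2_gt0 ?ln_add1_gt0. Qed.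

Lemma log2_add1_lt x y : 0 < x -> x < y -> log2 (1 + x) < log2 (1 + y).
Proof.
move=> x0 xy; rewrite ltr_pM2r ?invr_gt0 ?ln2_gt0//.
by rewrite ltr_ln ?posrE ?ltrD2l//; lra.
Qed.

(** Up to constants, this quotient is the energy per bit of a link; it makes the link terms of
    [Bfun] monotone. *)
Lemma div_log2_add1_le x y :
  0 < x -> x < y -> x / log2 (1 + x) <= y / log2 (1 + y).
Proof.
move=> x0 xy; have y0 : 0 < y := lt_trans x0 xy.
rewrite ler_pdivrMr ?log2_add1_gt0// mulrAC ler_pdivlMr ?log2_add1_gt0//.
rewrite /log2 !mulrA ler_pM2r ?invr_gt0 ?ln2_gt0//.
have x1 : 0 < 1 + x by lra.
have y1 : 0 < 1 + y by lra.
have := ln_sub_le y1 x1; have := div_add1_le_ln (ltW x0).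
rewrite !ler_pdivrMr// ler_pdivlMr//.
set a := ln (1 + x); set b := ln (1 + y) => xa ba.
(* The claim amounts to x (b - a) <= (y - x) a; after multiplication by 1 + x, the value x (y - x)
   separates the two sides. *)
rewrite -(ler_pM2r x1).
have : (y - x) * x <= (y - x) * (a * (1 + x)) by rewrite ler_pM2l// subr_gt0.
have : x * ((b - a) * (1 + x)) <= x * (1 + y - (1 + x)) by rewrite ler_pM2l.
by nra.
Qed.
End Log2.

(** * Optimality conditions by perturbation *)

Section Problem.
Variables (R : realType) (s : params R).
Hypothesis hs : admissible s.

Let rateU := link_rate (rho s) (Bmax s) (N0 s) (gainU s).
Let rateC := comp_rate (rho s) (alpha s) (kappa s).
Let rateD := link_rate 1 (Bmax s) (N0 s) (gainD s).

Lemma cpu_cap (t e : R) : 0 < t -> 0 <= e ->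
  (powR (e / (kappa s * t)) (1 / 3) < Fmax s) = (e / t < Fmax s ^+ 3 * kappa s).
Proof.
case: hs => _ [_ k0 _ _] _ [_ _ f0] _ t0 e0.
rewrite powR13_lt//; last by rewrite divr_ge0// mulr_ge0// ltW.
by rewrite invfM [_^-1 * _]mulrC mulrA ltr_pdivrMr.
Qed.

(** A competitor with positive objective splits the time equally and gives every stage the same
    small energy. *)
Lemma optimal_gt0 (p : allocation R) : optimal s p -> 0 < D p.
Proof.
move=> [_ opt]; case: hs => [[gU0 gD0 n0 B0] [al0 k0 etaS0 etaE0] [P00 T0 Ds0]
  [PU0 PD0 F0] /andP[rho0 _]].
pose t := T s / 3; have t0 : 0 < t by rewrite divr_gt0.
(* The budget spent per unit of the common energy. *)
have K0 : 0 < (etaS s)^-1 + 2 / etaE s by rewrite addr_gt0 ?divr_gt0 ?invr_gt0.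
have /filter_ex [e [e0 eU eD eF eP]] : \forall e \near (0 : R)^'+,
    [/\ 0 < e, e < PUmax s * t, e < PDmax s * t,
        e < Fmax s ^+ 3 * kappa s * t &
        e < P0 s * T s / ((etaS s)^-1 + 2 / etaE s)].
  near=> e; split; near: e; first exact: nbhs_right_gt;
    by apply: nbhs_right_lt; rewrite ?divr_gt0 ?mulr_gt0 ?exprn_gt0.
pose d := Num.min (rho s * Ds s)
  (Num.min (rateU t e) (Num.min (rateC t e) (rateD t e))).
have [d1 d2 d3 d4] : [/\ d <= rho s * Ds s, d <= rateU t e, d <= rateC t e &
    d <= rateD t e] by rewrite /d !ge_min !lexx !orbT.
rewrite /rateD /link_rate mul1r in d4.
have d0 : 0 < d.
  by rewrite !lt_min mulr_gt0// !link_rate_gt0// comp_rate_gt0.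
apply: (lt_le_trans d0); apply: (opt (Allocation d e e e t t t)).
rewrite /feasible /=; split=> //; first by rewrite (ltW e0).
- split; first by rewrite /t; lra.
  rewrite ltr_pdivlMr// in eP; apply: ltW; apply: le_lt_trans eP.
  by rewrite mulrDr mulrA; lra.
- by split; rewrite ?ler_pdivrMr ?(ltW eU) ?(ltW eD)// ltW// cpu_cap ?ltr_pdivrMr// ltW.
Unshelve. all: by end_near. Qed.

(** One small step serves all stages and budgets, and the least of the perturbed bounds would be a
    feasible objective above [D p]. Energy directions are in budget units, hence the factors [etaS]
    and [etaE]. *)
Lemma optimal_no_joint_improvement (p : allocation R) : optimal s p ->
  D p < rho s * Ds s ->
  forall dtu dtc dtd deu dec ded,
  tu p + tc p + td p < T s \/ dtu + dtc + dtd <= 0 ->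
  Eu p / etaS s + (Ec p + Ed p) / etaE s < P0 s * T s \/
    deu + dec + ded <= 0 ->
  improving rateU (D p) (PUmax s) (tu p) (Eu p) dtu (etaS s * deu) ->
  improving rateC (D p) (Fmax s ^+ 3 * kappa s) (tc p) (Ec p) dtc (etaE s * dec) ->
  ~ improving rateD (D p) (PDmax s) (td p) (Ed p) dtd (etaE s * ded).
Proof.
move=> [[_ _ _ [hT hE] _] opt] DDs dtu dtc dtd deu dec ded hdt hde iU iC iD.
case: hs => [[gU0 gD0 n0 B0] [al0 k0 etaS0 etaE0] _ _ _].
have /filter_ex [h [hT' hE' [tu0 eu0 dU cU] [tc0 ec0 dC cC] [td0 ed0 dD cD]]] :
    \forall h \near (0 : R)^'+,
    [/\ tu p + h * dtu + (tc p + h * dtc) + (td p + h * dtd) <= T s,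
        (Eu p + h * (etaS s * deu)) / etaS s + ((Ec p + h * (etaE s * dec)) +
          (Ed p + h * (etaE s * ded))) / etaE s <= P0 s * T s,
        [/\ 0 < tu p + h * dtu, 0 < Eu p + h * (etaS s * deu),
            D p < rateU (tu p + h * dtu) (Eu p + h * (etaS s * deu)) &
            (Eu p + h * (etaS s * deu)) / (tu p + h * dtu) < PUmax s],
        [/\ 0 < tc p + h * dtc, 0 < Ec p + h * (etaE s * dec),
            D p < rateC (tc p + h * dtc) (Ec p + h * (etaE s * dec)) &
            (Ec p + h * (etaE s * dec)) / (tc p + h * dtc) <
            Fmax s ^+ 3 * kappa s] &
        [/\ 0 < td p + h * dtd, 0 < Ed p + h * (etaE s * ded),
            D p < rateD (td p + h * dtd) (Ed p + h * (etaE s * ded)) &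
            (Ed p + h * (etaE s * ded)) / (td p + h * dtd) < PDmax s]].
  near=> h.
  have h0 : 0 < h by near: h; exact: nbhs_right_gt.
  split; [| |by near: h|by near: h|by near: h].
  - rewrite -subr_ge0 [leRHS](_ : _ = T s - (tu p + tc p + td p) +
      h * - (dtu + dtc + dtd)); last by ring.
    by near: h; apply: near_slack; rewrite ?subr_gt0 ?subr_ge0 ?oppr_ge0.
  - rewrite -subr_ge0 [leRHS](_ : _ = P0 s * T s -
      (Eu p / etaS s + (Ec p + Ed p) / etaE s) + h * - (deu + dec + ded)); last first.
      by field; rewrite !gt_eqF.
    by near: h; apply: near_slack; rewrite ?subr_gt0 ?subr_ge0 ?oppr_ge0.
set tu' := tu p + _ in hT' tu0 dU cU; set tc' := tc p + _ in hT' tc0 dC cC.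
set td' := td p + _ in hT' td0 dD cD; set eu' := Eu p + _ in hE' eu0 dU cU.
set ec' := Ec p + _ in hE' ec0 dC cC; set ed' := Ed p + _ in hE' ed0 dD cD.
pose d := Num.min (rho s * Ds s)
  (Num.min (rateU tu' eu') (Num.min (rateC tc' ec') (rateD td' ed'))).
have [d1 d2 d3 d4] : [/\ d <= rho s * Ds s, d <= rateU tu' eu',
    d <= rateC tc' ec' & d <= rateD td' ed'] by rewrite /d !ge_min !lexx !orbT.
rewrite /rateD /link_rate mul1r in d4.
have : D p < d by rewrite !lt_min DDs dU dC dD.
apply/negP; rewrite -leNgt; apply: (opt (Allocation d eu' ec' ed' tu' tc' td')).
rewrite /feasible /=; split=> //; first by rewrite !ltW.
- by split; [exact: ltW|exact: ltW|rewrite ltW// cpu_cap// ltW].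
Unshelve. all: by end_near. Qed.

Lemma stationarity (p : allocation R) : optimal s p -> energy_limited_at s p ->
  let xi := xi_of_snr s (etaS s) (gainU s) (snrU s p) in
  [/\ [/\ 0 < snrU s p, 0 < snrD s p & 0 < Ec p],
      [/\ D p = rateU (tu p) (Eu p), D p = rateC (tc p) (Ec p) &
          D p = rateD (td p) (Ed p)],
      tu p + tc p + td p = T s /\
      Eu p / etaS s + (Ec p + Ed p) / etaE s = P0 s * T s,
      xi_of_snr s (etaE s) (gainD s) (snrD s p) = xi &
      tc p * etaE s = 2 * xi * Ec p].
Proof.
move=> popt [DDs capU capD capC] xi; have D0 := optimal_gt0 popt.
have no := optimal_no_joint_improvement popt DDs.
case: hs => [[gU0 gD0 n0 B0] [al0 k0 etaS0 etaE0] _ _ /andP[rho0 _]].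
case: (popt) => [[[tu0 tc0 td0] [eu0 ec0 ed0] [_ dU dC dD] [hT hE] _] _].
have {}dD : D p <= rateD (td p) (Ed p) by rewrite /rateD /link_rate mul1r.
(* Zero energy would make a rate vanish, against D > 0; so all energies are positive. *)
have link0 c g t : link_rate c (Bmax s) (N0 s) g t 0 = 0.
  by rewrite /link_rate /log2 mulr0 mul0r addr0 ln1 mul0r mulr0.
have {}eu0 : 0 < Eu p.
  rewrite lt_neqAle eu0 andbT; apply/eqP => e; move: dU.
  rewrite -[leRHS]/(rateU (tu p) (Eu p)) -e /rateU link0.
  by rewrite leNgt D0.
have {}ed0 : 0 < Ed p.
  rewrite lt_neqAle ed0 andbT; apply/eqP => e; move: dD.
  by rewrite -e /rateD link0 leNgt D0.
have {}ec0 : 0 < Ec p.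
  rewrite lt_neqAle ec0 andbT; apply/eqP => e; move: dC.
  have third0 : (1 / 3 : R) != 0 by rewrite mul1r invr_eq0 pnatr_eq0.
  by rewrite -e mul0r powR0// mulr0 leNgt D0.
rewrite cpu_cap// ?ltW// in capC.
have snrU0 : 0 < snrU s p by rewrite divr_gt0// !mulr_gt0.
have snrD0 : 0 < snrD s p by rewrite divr_gt0// !mulr_gt0.
have costU := snr_cost_gt0 snrU0; have costD := snr_cost_gt0 snrD0.
pose kU := gainU s / (Bmax s * N0 s); pose kD := gainD s / (Bmax s * N0 s).
have kU0 : 0 < kU by rewrite divr_gt0// mulr_gt0.
have kD0 : 0 < kD by rewrite divr_gt0// mulr_gt0.
have unscale eta e : 0 < eta -> eta * - (e / eta) = - e :> R.
  by move=> eta0; field; rewrite gt_eqF.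
pose IU dt de := improving rateU (D p) (PUmax s) (tu p) (Eu p) dt (etaS s * de).
pose IC dt de := improving rateC (D p) (Fmax s ^+ 3 * kappa s) (tc p) (Ec p) dt
  (etaE s * de).
pose ID dt de := improving rateD (D p) (PDmax s) (td p) (Ed p) dt (etaE s * de).
(* The weights in these three claims are the gradients of the rates in time and budget energy, each
   up to a positive factor. *)
have gradU dt de : 0 < snr_cost (snrU s p) * dt + etaS s * kU * de -> IU dt de.
  move=> grad; apply: link_improving => //.
  by rewrite -/(snrU s p) -/kU [X in _ + X](_ : _ = etaS s * kU * de)//; ring.
have gradC dt de : 0 < 2 * Ec p * dt + etaE s * tc p * de -> IC dt de.
  move=> grad; apply: comp_improving => //.
  by rewrite [X in _ + X](_ : _ = etaE s * tc p * de)//; ring.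
have gradD dt de : 0 < snr_cost (snrD s p) * dt + etaE s * kD * de -> ID dt de.
  move=> grad; apply: link_improving => //.
  by rewrite -/(snrD s p) -/kD [X in _ + X](_ : _ = etaE s * kD * de)//; ring.
have shrinkU : D p < rateU (tu p) (Eu p) -> IU (- tu p) (- (Eu p / etaS s)).
  rewrite /IU unscale// => slack; apply: improving_shrink => //.
  by move=> *; apply: link_rate_homog.
have shrinkC : D p < rateC (tc p) (Ec p) -> IC (- tc p) (- (Ec p / etaE s)).
  rewrite /IC unscale// => slack; apply: improving_shrink => //.
  by move=> *; apply: comp_rate_homog.
have shrinkD : D p < rateD (td p) (Ed p) -> ID (- td p) (- (Ed p / etaE s)).
  rewrite /ID unscale// => slack; apply: improving_shrink => //.
  by move=> *; apply: link_rate_homog.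
have [nT nE [nU nC nD] uc ud] := no_joint_improvement tu0 tc0 td0
  (divr_gt0 eu0 etaS0) (divr_gt0 ec0 etaE0) (divr_gt0 ed0 etaE0)
  costU (mulr_gt0 etaS0 kU0) (mulr_gt0 (ltr0Sn R 1) ec0) (mulr_gt0 etaE0 tc0)
  costD (mulr_gt0 etaE0 kD0) gradU gradC gradD shrinkU shrinkC shrinkD no.
have tight (x y : R) : x <= y -> ~ x < y -> x = y.
  by rewrite le_eqVlt => /orP[/eqP|].
split=> //; [by split; apply: tight|by split; apply: tight| |].
- rewrite /xi !xi_of_snrE.
  have -> : etaE s * gainD s / (Bmax s * N0 s * snr_cost (snrD s p)) =
      etaE s * kD / snr_cost (snrD s p) by rewrite /kD; field; rewrite !gt_eqF.
  have -> : etaS s * gainU s / (Bmax s * N0 s * snr_cost (snrU s p)) =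
      etaS s * kU / snr_cost (snrU s p) by rewrite /kU; field; rewrite !gt_eqF.
  by apply/eqP; rewrite eqr_div ?lt0r_neq0// mulrC ud mulrC.
- have -> : xi = etaS s * kU / snr_cost (snrU s p).
    by rewrite /xi xi_of_snrE /kU; field; rewrite !gt_eqF.
  apply: (mulfI (lt0r_neq0 costU)).
  rewrite [LHS](_ : _ = snr_cost (snrU s p) * (etaE s * tc p)); last by ring.
  by rewrite uc; field; rewrite gt_eqF.
Qed.

(** * Monotonicity of A and B, and the budget equation *)

Lemma gammaU_gt0 (xi : R) : 0 < xi -> 0 < gammaU s xi.
Proof.
case: hs => [[gU0 gD0 n0 B0] [_ _ etaS0 etaE0] _ _ _] xi0.
by case: (snr_of_xiP etaS0 gU0 B0 n0 xi0).
Qed.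

Lemma gammaD_gt0 (xi : R) : 0 < xi -> 0 < gammaD s xi.
Proof.
case: hs => [[gU0 gD0 n0 B0] [_ _ etaS0 etaE0] _ _ _] xi0.
by case: (snr_of_xiP etaE0 gD0 B0 n0 xi0).
Qed.

Lemma decreasing_gammaU : decreasing_pos (gammaU s).
Proof.
by case: hs => [[? ? ? ?] [? ? ? ?] _ _ _]; exact: decreasing_snr_of_xi.
Qed.

Lemma decreasing_gammaD : decreasing_pos (gammaD s).
Proof.
by case: hs => [[? ? ? ?] [? ? ? ?] _ _ _]; exact: decreasing_snr_of_xi.
Qed.

Lemma Afun_gt0 (xi : R) : 0 < xi -> 0 < Afun s xi.
Proof.
move=> xi0; have u0 := gammaU_gt0 xi0; have d0 := gammaD_gt0 xi0.
case: hs => [[? ? ? B0] [al0 k0 ? etaE0] _ _ /andP[rho0 _]].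
have q0 : 0 < 2 * xi / etaE s by rewrite divr_gt0 ?mulr_gt0.
by rewrite !addr_gt0 ?divr_gt0 ?mulr_gt0 ?invr_gt0 ?ln_add1_gt0 ?ln2_gt0 ?powR_gt0.
Qed.

Lemma Bfun_gt0 (xi : R) : 0 < xi -> 0 < Bfun s xi.
Proof.
move=> xi0; have u0 := gammaU_gt0 xi0; have d0 := gammaD_gt0 xi0.
case: hs => [[? ? ? B0] [al0 k0 ? etaE0] _ _ /andP[rho0 _]].
have q0 : 0 < 2 * xi by rewrite mulr_gt0.
by rewrite !addr_gt0 ?divr_gt0 ?mulr_gt0 ?invr_gt0 ?ln_add1_gt0 ?ln2_gt0 ?powR_gt0.
Qed.

Lemma Afun_lt x y : 0 < x -> x < y -> Afun s x < Afun s y.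
Proof.
move=> x0 xy; have y0 := lt_trans x0 xy.
have uy0 := gammaU_gt0 y0; have dy0 := gammaD_gt0 y0.
have uxy := decreasing_gammaU x0 xy; have dxy := decreasing_gammaD x0 xy.
case: hs => [[? ? ? B0] [al0 k0 ? etaE0] _ _ /andP[rho0 _]].
have inv_lt K u v : 0 < K -> 0 < v -> v < u ->
    1 / (K * log2 (1 + u)) < 1 / (K * log2 (1 + v)) :> R.
  move=> K0 v0 vu; have lv0 := log2_add1_gt0 v0.
  have luv := log2_add1_lt v0 vu; have lu0 := lt_trans lv0 luv.
  by rewrite !div1r ltf_pV2 ?ltr_pM2l// posrE pmulr_rgt0.
rewrite /Afun; apply: ltrD; first by apply: ltrD; apply: inv_lt => //; rewrite mulr_gt0.
rewrite ltr_pM2l ?divr_gt0 ?mulr_gt0 ?powR_gt0//.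
apply: gt0_ltr_powR; rewrite ?nnegrE ?divr_ge0 ?mulr_ge0 ?(ltW x0) ?(ltW y0) ?(ltW etaE0)//.
by rewrite ltr_pM2r ?invr_gt0// ltr_pM2l.
Qed.

(** The link terms are compared only weakly; strictness comes from the computing term. *)
Lemma Bfun_lt x y : 0 < x -> x < y -> Bfun s y < Bfun s x.
Proof.
move=> x0 xy; have y0 := lt_trans x0 xy.
have uy0 := gammaU_gt0 y0; have dy0 := gammaD_gt0 y0.
have uxy := decreasing_gammaU x0 xy; have dxy := decreasing_gammaD x0 xy.
case: hs => [[? ? n0 B0] [al0 k0 etaS0 etaE0] _ _ /andP[rho0 _]].
have link_le K u v : 0 < K -> 0 < v -> v < u ->
    v * N0 s / (K * log2 (1 + v)) <= u * N0 s / (K * log2 (1 + u)).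
  move=> K0 v0 vu; have u0 := lt_trans v0 vu.
  have split_div z : 0 < z -> z * N0 s / (K * log2 (1 + z)) = N0 s / K * (z / log2 (1 + z)).
    by move=> z0; field; rewrite !gt_eqF ?log2_add1_gt0.
  by rewrite !split_div// ler_pM2l ?divr_gt0// div_log2_add1_le.
rewrite /Bfun ler_ltD//; first by rewrite lerD ?link_le ?mulr_gt0.
rewrite ltr_pM2l ?divr_gt0 ?mulr_gt0 ?powR_gt0// !powRN.
rewrite ltf_pV2 ?posrE ?powR_gt0 ?mulr_gt0//.
by apply: gt0_ltr_powR; rewrite ?nnegrE ?mulr_ge0 ?(ltW x0) ?(ltW y0) ?ltr_pM2l.
Qed.

Lemma budget_unique xi : 0 < xi -> P0 s * Afun s xi - Bfun s xi = 0 ->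
  forall z, 0 < z -> (P0 s * Afun s z - Bfun s z = 0 <-> z = xi).
Proof.
case: hs => _ _ [P00 _ _] _ _ xi0 eq0 z z0; split=> [eqz|->//].
have incr x y : 0 < x -> x < y ->
    P0 s * Afun s x - Bfun s x < P0 s * Afun s y - Bfun s y.
  by move=> x0 xy; rewrite ltrB ?Bfun_lt// ltr_pM2l ?Afun_lt.
have [zx|xz|//] := ltgtP z xi.
- by have := incr _ _ z0 zx; rewrite eq0 eqz ltxx.
- by have := incr _ _ xi0 xz; rewrite eq0 eqz ltxx.
Qed.

Lemma closed_form_time xi d :
  tu (closed_form s xi d) + tc (closed_form s xi d) + td (closed_form s xi d) =
  d * Afun s xi.
Proof. by rewrite /closed_form /Afun /=; ring. Qed.

Lemma closed_form_energy xi d : 0 < xi ->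
  Eu (closed_form s xi d) / etaS s +
    (Ec (closed_form s xi d) + Ed (closed_form s xi d)) / etaE s =
  d * Bfun s xi.
Proof.
move=> xi0; have u0 := gammaU_gt0 xi0; have d0 := gammaD_gt0 xi0.
case: hs => [[gU0 gD0 n0 B0] [al0 k0 etaS0 etaE0] _ _ /andP[rho0 _]].
rewrite /closed_form /Bfun /=.
(* Dividing the computing energy by [etaE] produces the right-hand form. *)
have -> : etaE s `^ (- (1 / 3)) = etaE s `^ (2 / 3) / etaE s.
  have Y0 : 0 < etaE s `^ (1 / 3) by exact: powR_gt0.
  rewrite powRN powR23E; have := cube_powR13 (ltW etaE0).
  by set Y := etaE s `^ (1 / 3) in Y0 * => <-; field; rewrite gt_eqF.
by field; rewrite !gt_eqF ?log2_add1_gt0.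
Qed.

End Problem.

(** * Assembly of the semi-closed form *)

Theorem proposition3 (R : realType) (s : params R) (hs : admissible s) :
  [/\ decreasing_pos (xi_of_snr s (etaS s) (gainU s)),
      decreasing_pos (xi_of_snr s (etaE s) (gainD s)),
      forall xi : R, 0 < xi ->
        (exists! gamma : R,
           0 < gamma /\ xi_of_snr s (etaS s) (gainU s) gamma = xi) /\
        (exists! gamma : R,
           0 < gamma /\ xi_of_snr s (etaE s) (gainD s) gamma = xi) &
      decreasing_pos (gammaU s) /\ decreasing_pos (gammaD s)] /\
  forall p : allocation R, optimal s p -> energy_limited_at s p ->
  exists xi : R,
  [/\ 0 < xi,
      [/\ xi_of_snr s (etaS s) (gainU s) (snrU s p) = xi,
          xi_of_snr s (etaE s) (gainD s) (snrD s p) = xi,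
          snrU s p = gammaU s xi &
          snrD s p = gammaD s xi],
      p = closed_form s xi (D p),
      forall z : R, 0 < z -> (P0 s * Afun s z - Bfun s z = 0 <-> z = xi) &
      D p = T s / Afun s xi /\ D p = T s * P0 s / Bfun s xi].
Proof.
case: (hs) => [[gU0 gD0 n0 B0] [al0 k0 etaS0 etaE0] [P00 T0 _] _ /andP[rho0 _]].
split.
  split; [exact: decreasing_xi_of_snr|exact: decreasing_xi_of_snr| |].
    by move=> xi xi0; split; exact: unique_snr.
  by split; [exact: decreasing_gammaU|exact: decreasing_gammaD].
move=> p popt plim.
have D0 := optimal_gt0 hs popt.
(* The parameter is read off the uplink SNR, so the uplink equation holds by definition. *)
have := stationarity hs popt plim; set xi := xi_of_snr _ _ _ _ => /=.
move=> [[u0 d0 ec0] [rU rC rD] [sT sE] xiD tcE].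
have [[tu0 tc0 td0] [eu0 _ ed0] _ _ _] := popt.1.
have {}eu0 : 0 < Eu p.
  move: u0; rewrite /snrU pmulr_lgt0 ?pmulr_rgt0//.
  by rewrite invr_gt0 !mulr_gt0.
have {}ed0 : 0 < Ed p.
  move: d0; rewrite /snrD pmulr_lgt0 ?pmulr_rgt0//.
  by rewrite invr_gt0 !mulr_gt0.
have xi0 : 0 < xi by exact: xi_of_snr_gt0.
have gU : snrU s p = gammaU s xi by rewrite /gammaU snr_of_xi_of_snr.
have gD : snrD s p = gammaD s xi by rewrite /gammaD -xiD snr_of_xi_of_snr.
have pE : p = closed_form s xi (D p).
  have [tuE euE] := link_closed_form rho0 B0 n0 gU0 tu0 eu0 erefl rU.
  have [tdE edE] := link_closed_form ltr01 B0 n0 gD0 td0 ed0 erefl rD.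
  have [tcE' ecE] := comp_closed_form rho0 al0 k0 tc0 ec0 etaE0 xi0 (ltW D0) rC tcE.
  rewrite -/(snrU s p) gU in tuE euE; rewrite -/(snrD s p) gD !mul1r in tdE edE.
  rewrite /closed_form -tuE -euE -tdE -edE -tcE' -ecE.
  by case: (p).
have A0 := Afun_gt0 hs xi0; have B0' := Bfun_gt0 hs xi0.
have DA : D p * Afun s xi = T s by rewrite -closed_form_time// -pE.
have DB : D p * Bfun s xi = P0 s * T s by rewrite -closed_form_energy// -pE.
exists xi; split=> //.
(* Multiplied by [D p], both terms of the equation equal P0 T. *)
- apply: budget_unique => //; apply: (mulfI (lt0r_neq0 D0)).
  by rewrite mulrBr DB mulrCA DA subrr mulr0.
- by split; [rewrite -DA|rewrite [T s * _]mulrC -DB]; rewrite mulfK// gt_eqF.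
Qed.
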